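(* There exists $t_0$ such that the following holds. Let $G$ be a triangle-free graph on $n$ vertices with average degree $t \ge t_0$. Then the number $i(G)$ of independent sets in $G$ satisfies \[ i(G) \geq 2^{\frac{n}{2400\,t}\log^2 t}. \]
   Context: All logarithms are base $2$. For a graph $G$, $i(G)$ denotes the number of independent sets in $G$ (subsets $I\subseteq V(G)$ with no two vertices of $I$ adjacent). The average degree of a graph on $n$ vertices with $e$ edges is $2e/n$. The phrase ''where $t$ is sufficiently large'' in the paper is expressed here by the existence of the threshold $t_0$. *)

(* Defs.v *)
From mathcomp Require Import all_boot all_order all_algebra.
From mathcomp Require Import all_classical all_reals all_analysis.

Set Implicit Arguments.
Unset Strict Implicit.
Unset Printing Implicit Defensive.

Import Order.TTheory GRing.Theory Num.Theory.

Local Open Scope ring_scope.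

(* MathComp / MathComp-Analysis development. A finite simple graph is given by
   its adjacency relation [e : rel V] on a finite type [V], assumed symmetric
   and irreflexive where it is used. *)

Definition edges (V : finType) (e : rel V) : {set {set V}} :=
  [set [set p.1; p.2] | p : V * V & e p.1 p.2].

Definition triangle_free (V : finType) (e : rel V) : Prop :=
  forall x y z : V, ~ [/\ e x y, e y z & e x z].

Definition independent (V : finType) (e : rel V) (I : {set V}) : bool :=
  [forall x in I, forall y in I, ~~ e x y].

Definition num_independent (V : finType) (e : rel V) : nat :=
  #|[set I : {set V} | independent e I]|.

(* On the graph with no vertex this is 0, as 0^-1 = 0. *)
Definition average_degree (R : realType) (V : finType) (e : rel V) : R :=
  2 * #|edges e|%:R / #|V|%:R.

Definition log2 (R : realType) (x : R) : R := ln x / ln 2.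

(* Main.v *)
(* Let S be the set of vertices of degree at most 2t, so |S| >= n/2, and draw an
   independent set I of G[S] with weight x^-|I|, where x^4 = 2t bounds the
   degrees in G[S].  Condition on I outside the closed neighbourhood of v: if k
   neighbours of v remain available then, as G is triangle-free, the rest of I
   is either {v} or an arbitrary set of available neighbours.  A large k makes
   the expected number of neighbours of v in I large, and a small k makes v
   itself likely to be in I, so the mean of x^4 [v in I] + |I cap N(v)| is at
   least (ln x)/4.  Summing over v bounds E|I| from below by
   |S| ln x / (8 x^4), and by Jensen's inequality the number of independent sets
   is at least E[x^|I|] >= x^(E|I|). *)
Require Import Defs.
From mathcomp Require Import all_boot all_order all_algebra.
From mathcomp Require Import all_classical all_reals all_analysis.
From mathcomp Require Import ring lra.

Import boot.finset.
Import Order.TTheory GRing.Theory Num.Theory.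

Local Open Scope ring_scope.

(** * Binomial sums over the subsets of a finite set *)

Lemma sum_subsets_by_card (R : nmodType) (T : finType) (A : {set T})
    (g : nat -> R) :
  \sum_(B : {set T} | B \subset A) g #|B| =
  \sum_(k < #|A|.+1) g k *+ 'C(#|A|, k).
Proof.
rewrite (partition_big (fun B : {set T} => inord #|B| : 'I_#|A|.+1) xpredT) //=.
apply: eq_bigr => k _; rewrite -cards_draws -sumr_const.
apply: eq_big => [B|B /andP[sBA /eqP <-]]; last first.
  by rewrite inordK // ltnS subset_leq_card.
rewrite inE; apply: andb_id2l => sBA.
by rewrite -val_eqE /= inordK // ltnS subset_leq_card.
Qed.

Lemma sum_subsets_expr (R : comPzRingType) (T : finType) (A : {set T}) (l : R) :
  \sum_(B : {set T} | B \subset A) l ^+ #|B| = (1 + l) ^+ #|A|.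
Proof.
rewrite (@sum_subsets_by_card _ _ _ (fun k => l ^+ k)) exprDn.
by apply: eq_bigr => k _; rewrite expr1n mul1r.
Qed.

(** This is [l] times the derivative in [l] of the binomial formula. The factor [1 + l] on the left
    avoids the exponent [#|A| - 1], which would go wrong for empty [A]. *)
Lemma sum_subsets_card_expr (R : comPzRingType) (T : finType) (A : {set T})
    (l : R) :
  (1 + l) * (\sum_(B : {set T} | B \subset A) #|B|%:R * l ^+ #|B|) =
  #|A|%:R * l * (1 + l) ^+ #|A|.
Proof.
rewrite (@sum_subsets_by_card _ _ _ (fun k => k%:R * l ^+ k)).
case: #|A| => [|n]; first by rewrite big_ord_recl big_ord0 !mul0r mul0rn addr0 mulr0.
rewrite big_ord_recl mul0r mul0rn add0r exprS.
rewrite [RHS]mulrCA -[in RHS]mulrA; congr (_ * _).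
rewrite exprDn !mulr_sumr; apply: eq_bigr => k _ /=.
rewrite expr1n mul1r /bump /= add1n exprS.
rewrite -(mulr_natr (_ * _)) -(mulr_natr (l ^+ k)).
have /(congr1 (fun m => m%:R : R)) := mul_bin_diag n.+1 k.
rewrite /= !natrM => E.
transitivity (k.+1%:R * 'C(n.+1, k.+1)%:R * (l * l ^+ k)); first by ring.
by rewrite -E; ring.
Qed.

(** * Independent sets with a prescribed part outside a closed neighbourhood *)

Definition neighbours {V : finType} (e : rel V) (v : V) : {set V} :=
  [set u | e v u].

(** The available neighbours of [v], when [J] is the part of the independent set outside the closed
    neighbourhood of [v]. *)
Definition unblocked {V : finType} (e : rel V) (S : {set V}) (v : V)
    (J : {set V}) : {set V} :=
  [set u in S | e v u & [forall w in J, ~~ e u w]].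

Lemma independentP {V : finType} {e : rel V} {I : {set V}} :
  reflect {in I &, forall x y, ~~ e x y} (independent e I).
Proof.
apply: (iffP forall_inP) => [h x y xI yI|h x xI].
  exact: (forall_inP (h x xI)).
by apply/forall_inP => y yI; apply: h.
Qed.

(** If [I] contains [v], it contains no neighbour of [v] and must be [v |: J]. Otherwise [I] adds to
    [J] some unblocked neighbours of [v], and these can be chosen freely because they are pairwise
    non-adjacent. *)
Lemma sum_fibre (R : nmodType) (V : finType) (e : rel V) (S : {set V}) (v : V)
    (J : {set V}) (g : {set V} -> R) :
  symmetric e -> irreflexive e -> triangle_free e -> v \in S ->
  independent e J -> J \subset S -> [disjoint J & v |: neighbours e v] ->
  \sum_(I : {set V} | (independent e I && (I \subset S)) &&
      (I :\: (v |: neighbours e v) == J)) g I =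
  g (v |: J) + \sum_(T : {set V} | T \subset unblocked e S v J) g (J :|: T).
Proof.
move=> sym irr tf vS Ji JS dJ.
have vJ u : u \in J -> (u != v) * (~~ e v u).
  move=> uJ; have := disjointFr dJ uJ.
  by rewrite !inE => /negbT; rewrite negb_or => /andP[-> ->].
rewrite (bigD1 (v |: J)) /=; last first.
  apply/andP; split; first (apply/andP; split).
  - apply/independentP => x y; rewrite !inE.
    move=> /orP[/eqP->|xJ] /orP[/eqP->|yJ]; first by rewrite irr.
    + by rewrite (vJ y yJ).
    + by rewrite sym (vJ x xJ).
    + exact: (independentP Ji).
  - by rewrite subUset sub1set vS JS.
  - apply/eqP/setP => u; rewrite !inE.
    case: eqP => [->|_] /=; first by apply/esym/negbTE/negP=> /vJ[]; rewrite eqxx.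
    case evu : (e v u) => //=; apply/esym/negbTE/negP => /vJ[_].
    by rewrite evu.
congr (_ + _).
(* Intersecting with the neighbourhood of [v] recovers [T] from [J :|: T]. *)
rewrite (reindex_onto (fun T => J :|: T) (fun I => I :&: neighbours e v)) /=.
  apply: eq_bigl => T; apply/idP/idP.
    move=> /andP[/andP[/andP[/andP[iJT sJT] /eqP eJ] _] /eqP eT].
    apply/fintype.subsetP => u uT; rewrite inE (fintype.subsetP sJT) ?inE ?uT ?orbT //=.
    apply/andP; split; first by move: uT; rewrite -eT !inE => /andP[].
    apply/forall_inP => w wJ; apply: (independentP iJT);
      by rewrite !inE ?uT ?wJ ?orbT.
  move=> /fintype.subsetP TA.
  have TN u : u \in T -> [/\ u \in S, e v u & {in J, forall w, ~~ e u w}].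
    by move=> /TA; rewrite inE => /and3P[? ? /forall_inP].
  have eT : (J :|: T) :&: neighbours e v = T.
    apply/setP => u; rewrite !inE.
    case uT : (u \in T); first by have [_ -> _] := TN u uT; rewrite orbT.
    rewrite orbF; apply/negP => /andP[/vJ[_]] /negP; exact.
  rewrite eT eqxx andbT; apply/andP; split; last first.
    apply/eqP => /setP/(_ v); rewrite !inE eqxx /=.
    case/orP => [/vJ[]|/TN[_]]; first by rewrite eqxx.
    by rewrite irr.
  apply/andP; split; first (apply/andP; split).
  - apply/independentP => x y; rewrite !inE.
    move=> /orP[xJ|xT] /orP[yJ|yT].
    + exact: (independentP Ji).
    + by rewrite sym; have [_ _ ->] := TN y yT.
    + by have [_ _ ->] := TN x xT.
    (* Two adjacent elements of [T] would form a triangle with [v]. *)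
    + apply/negP => exy; apply: (tf v x y).
      by have [_ -> _] := TN x xT; have [_ -> _] := TN y yT.
  - rewrite subUset JS; apply/fintype.subsetP => u /TN[].
    by [].
  - apply/eqP/setP => u; rewrite !inE.
    case uJ : (u \in J) => /=.
      by have [/negbTE-> /negbTE->] := vJ u uJ.
    case uT : (u \in T); last by rewrite andbF.
    by have [_ -> _] := TN u uT; rewrite orbT.
(* It remains that [I] is the union of [J] and its neighbours of [v]. This could fail only for
   [v \in I], which would make [I] the excluded set [v |: J]. *)
move=> I /andP[/andP[/andP[iI sI] /eqP eJ] nI].
apply/setP => u; rewrite !inE -eJ !inE.
case uI : (u \in I); rewrite ?andbF //= andbT.
case: (e v u); rewrite ?orbT // !orbF.
case: eqP => // uv; case/negP: nI; apply/eqP/setP => w.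
rewrite !inE -eJ !inE -uv.
case: eqP => [->|_] //=.
case euw : (e u w) => //=; apply/negbTE/negP => wI.
by have := independentP iI u w uI wI; rewrite euw.
Qed.

(** * Lower bounds for the expected occupancy *)

(** Within a fibre, [{v}] has weight [x^-1] and the sets of available neighbours have total weight
    [q = (1 + x^-1) ^+ k]. If [q <= x], the term [x ^+ 3] coming from [v] suffices. If [q > x],
    taking logarithms gives [k / x >= ln x], and the neighbours suffice. *)
Lemma local_occupancy_ge (R : realType) (x : R) (k : nat) : 1 <= x ->
  ln x / 4 * (x^-1 + (1 + x^-1) ^+ k) <=
  x ^+ 4 * x^-1 + k%:R * x^-1 * (1 + x^-1) ^+ k / (1 + x^-1).
Proof.
move=> x1.
have x0 : 0 < x by apply: lt_le_trans x1.
have l0 : 0 < x^-1 by rewrite invr_gt0.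
have l1 : x^-1 <= 1 by rewrite invf_le1.
have lnx0 : 0 <= ln x by apply: ln_ge0.
have lnx : ln x <= x by rewrite ltW // ln_sublinear.
have q1 : 1 <= (1 + x^-1) ^+ k by apply: exprn_ege1; lra.
have -> : x ^+ 4 * x^-1 = x ^+ 3 by rewrite exprSr mulfK // gt_eqF.
set q := (1 + x^-1) ^+ k in q1 *.
have kl0 : 0 <= k%:R * x^-1 :> R by rewrite mulr_ge0 // ltW.
have [qx|xq] := lerP q x.
  have : 0 <= k%:R * x^-1 * q / (1 + x^-1).
    by rewrite divr_ge0 ?mulr_ge0 //; lra.
  have : ln x / 4 * (x^-1 + q) <= x / 4 * (2 * x) by apply: ler_pM; lra.
  have : x * x <= x ^+ 3 by nra.
  have : 0 <= x * x by apply: mulr_ge0; lra.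
  lra.
have kx : ln x <= k%:R * x^-1.
  have : ln x <= ln q by rewrite ler_ln ?posrE //; lra.
  rewrite /q lnXn; last lra.
  move=> /le_trans; apply; rewrite -[leLHS]mulr_natl.
  by apply: ler_wpM2l => //; apply: le_ln1Dx; lra.
have : ln x * q / 2 <= k%:R * x^-1 * q / (1 + x^-1).
  apply: ler_pM; first by rewrite mulr_ge0 //; lra.
  - lra.
  - by rewrite ler_wpM2r //; lra.
  - by rewrite lef_pV2 ?posrE; lra.
have : 0 <= x ^+ 3 by apply: exprn_ge0; lra.
have : ln x / 4 * (x^-1 + q) <= ln x / 4 * (2 * q).
  by apply: ler_wpM2l; lra.
lra.
Qed.

(* The fibres of [I :\: N] condition on I outside the closed neighbourhood N. *)
Lemma occupancy_ge (R : realType) (V : finType) (e : rel V) (S : {set V})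
    (v : V) (x : R) :
  symmetric e -> irreflexive e -> triangle_free e -> 1 <= x -> v \in S ->
  ln x / 4 * (\sum_(I : {set V} | independent e I && (I \subset S))
     x^-1 ^+ #|I|) <=
  \sum_(I : {set V} | independent e I && (I \subset S)) x^-1 ^+ #|I| *
     (x ^+ 4 * (v \in I)%:R + #|I :&: neighbours e v|%:R).
Proof.
move=> sym irr tf x1 vS.
have l0 : 0 < x^-1 by rewrite invr_gt0; lra.
set N := v |: neighbours e v.
pose P (J : {set V}) := (independent e J && (J \subset S)) && [disjoint J & N].
have PD (I : {set V}) : independent e I && (I \subset S) -> P (I :\: N).
  move=> /andP[iI sI]; apply/andP; split; last first.
    by rewrite -setI_eq0 setIDAC -setIDA setDv setI0.
  apply/andP; split; last exact: fintype.subset_trans (subsetDl _ _) sI.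
  apply/independentP => a b; rewrite in_setD => /andP[_ aI].
  by rewrite in_setD => /andP[_ bI]; apply: (independentP iI).
rewrite !(partition_big (fun I : {set V} => I :\: N) P PD) mulr_sumr /=.
apply: ler_sum => J /andP[/andP[iJ sJ] dJ].
rewrite !sum_fibre //.
have JN u : u \in J -> u != v /\ ~~ e v u.
  by move=> uJ; have := disjointFr dJ uJ; rewrite !inE => /norP.
have vJ : v \notin J by apply/negP => /JN[]; rewrite eqxx.
set A := unblocked e S v J.
have AN u : u \in A -> e v u by rewrite inE => /and3P[].
have card_cat (T : {set V}) : T \subset A -> #|J :|: T| = (#|J| + #|T|)%N.
  move=> /fintype.subsetP TA; rewrite cardsU (_ : J :&: T = set0) ?cards0 ?subn0 //.
  apply/setP => u; rewrite !inE; apply/negP => /andP[/JN[_ /negP h] /TA/AN].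
  exact: h.
have cap_cat (T : {set V}) : T \subset A -> (J :|: T) :&: neighbours e v = T.
  move=> /fintype.subsetP TA; apply/setP => u; rewrite !inE.
  case uT : (u \in T); first by rewrite (AN _ (TA _ uT)) orbT.
  by rewrite orbF; apply/negP => /andP[/JN[_ /negP h] /h].
have v_cat (T : {set V}) : T \subset A -> (v \in J :|: T) = false.
  move=> /fintype.subsetP TA; rewrite inE (negbTE vJ) /=.
  by apply/negP => /TA/AN; rewrite irr.
have -> : \sum_(T : {set V} | T \subset A) x^-1 ^+ #|J :|: T| =
    x^-1 ^+ #|J| * (1 + x^-1) ^+ #|A|.
  rewrite -sum_subsets_expr mulr_sumr; apply: eq_bigr => T TA.
  by rewrite card_cat // exprD.
have -> : \sum_(T : {set V} | T \subset A) x^-1 ^+ #|J :|: T| *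
    (x ^+ 4 * (v \in J :|: T)%:R + #|(J :|: T) :&: neighbours e v|%:R) =
    x^-1 ^+ #|J| * (#|A|%:R * x^-1 * (1 + x^-1) ^+ #|A| / (1 + x^-1)).
  rewrite -sum_subsets_card_expr mulrC -(mulrC (\sum_(_ | _) _)) mulfK; last lra.
  rewrite mulr_suml; apply: eq_bigr => T TA.
  by rewrite card_cat // exprD cap_cat // v_cat // mulr0 add0r; ring.
rewrite cardsU1 vJ add1n setU11 mulr1 (exprS _ #|J|).
have -> : #|(v |: J) :&: neighbours e v| = 0%N.
  apply/eqP; rewrite cards_eq0; apply/eqP/setP => u; rewrite !inE.
  apply/negP => /andP[/orP[/eqP->|/JN[_ /negP h] /h//]].
  by rewrite irr.
(* Both sides are now [x^-1 ^+ #|J|] times those of the local inequality with [k = #|A|]. *)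
have w0 : 0 <= x^-1 ^+ #|J| by rewrite exprn_ge0 // ltW.
have := ler_wpM2l w0 (local_occupancy_ge R x #|A| x1).
congr (_ <= _); ring.
Qed.

(** Sum the occupancy bound over [v] in [S]. The terms for [v \in I] give [x ^+ 4 * #|I|]. Counting
    pairs of adjacent vertices from [I] and [S] the other way round, the degree bound gives at most
    [x ^+ 4 * #|I|] again, whence the factor 2. *)
Lemma mean_size_ge (R : realType) (V : finType) (e : rel V) (S : {set V})
    (x : R) :
  symmetric e -> irreflexive e -> triangle_free e -> 1 <= x ->
  (forall v, v \in S -> #|S :&: neighbours e v|%:R <= x ^+ 4) ->
  #|S|%:R * (ln x / 4 * (\sum_(I : {set V} | independent e I && (I \subset S))
     x^-1 ^+ #|I|)) <=
  2 * x ^+ 4 * (\sum_(I : {set V} | independent e I && (I \subset S))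
     x^-1 ^+ #|I| * #|I|%:R).
Proof.
move=> sym irr tf x1 maxdeg.
have l0 : 0 < x^-1 by rewrite invr_gt0; lra.
rewrite mulr_natl -sumr_const.
apply: le_trans
  (ler_sum _ (fun v vS => occupancy_ge R V e S v x sym irr tf x1 vS)) _.
rewrite exchange_big mulr_sumr; apply: ler_sum => I /andP[_ IS].
rewrite -mulr_sumr mulrCA; apply: ler_wpM2l; first by rewrite exprn_ge0 // ltW.
rewrite big_split /= -mulr_sumr -natr_sum.
have -> : (\sum_(v in S) (v \in I) = #|I|)%N.
  rewrite -sum1_card big_mkcond [RHS]big_mkcond; apply: eq_bigr => v _.
  case vS : (v \in S); first by case: (v \in I).
  by case: ifP => // /(fintype.subsetP IS); rewrite vS.
have -> : \sum_(v in S) #|I :&: neighbours e v|%:R =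
    \sum_(u in I) #|S :&: neighbours e u|%:R :> R.
  rewrite -!natr_sum; congr _%:R.
  transitivity (\sum_(v in S) \sum_(u in I) e v u)%N.
    apply: eq_bigr => v _; rewrite -sum1_card big_mkcond [RHS]big_mkcond.
    by apply: eq_bigr => u _; rewrite !inE; case: (u \in I); case: (e v u).
  rewrite exchange_big; apply: eq_bigr => u _; rewrite -sum1_card.
  rewrite big_mkcond [RHS]big_mkcond.
  by apply: eq_bigr => v _; rewrite !inE sym; case: (v \in S); case: (e u v).
have : \sum_(u in I) #|S :&: neighbours e u|%:R <= \sum_(u in I) x ^+ 4.
  by apply: ler_sum => u uI; apply/maxdeg/(fintype.subsetP IS).
by rewrite sumr_const -[x ^+ 4 *+ _]mulr_natl; lra.
Qed.

(** * From the mean size to the number of independent sets *)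

Lemma num_independent_ge (R : realType) (V : finType) (e : rel V)
    (S : {set V}) (x : R) :
  symmetric e -> irreflexive e -> triangle_free e -> 1 <= x ->
  (forall v, v \in S -> #|S :&: neighbours e v|%:R <= x ^+ 4) ->
  expR (#|S|%:R * ln x ^+ 2 / (8 * x ^+ 4)) <= (num_independent e)%:R :> R.
Proof.
move=> sym irr tf x1 maxdeg.
have x0 : 0 < x by lra.
have x40 : 0 < x ^+ 4 by apply: exprn_gt0.
have lnx0 : 0 <= ln x by apply: ln_ge0.
have := mean_size_ge R V e S x sym irr tf x1 maxdeg.
set Z := \sum_(I | _) _; set M := \sum_(I | _) _ => ZM.
(* [E] bounds the mean size [M / Z] from below. *)
pose E := #|S|%:R * ln x / (8 * x ^+ 4).
have EZM : E * Z <= M.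
  rewrite /E mulrAC ler_pdivrMr; last lra.
  lra.
(* The empty set alone contributes 1. *)
have Z1 : 1 <= Z.
  rewrite /Z (bigD1 (set0 : {set V})) /=; last first.
    rewrite sub0set andbT; apply/independentP => a b.
    by rewrite inE.
  rewrite cards0 expr0 lerDl sumr_ge0 // => I _.
  by rewrite exprn_ge0 // invr_ge0 ltW.
have -> : #|S|%:R * ln x ^+ 2 / (8 * x ^+ 4) = E * ln x.
  by rewrite /E expr2; ring.
rewrite -[leLHS]mulr1 -ler_pdivlMl ?expR_gt0 // -expRN.
apply: (le_trans Z1).
pose F := \sum_(I : {set V} | independent e I && (I \subset S)) (1 : R).
apply: (@le_trans _ _ (expR (- (E * ln x)) * F)); last first.
  rewrite ler_wpM2l ?expR_ge0 // /F sumr_const ler_nat /num_independent.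
  rewrite cardsE; apply: subset_leq_card.
  by apply/fintype.subsetP => I /andP[].
(* tangent line of exp at 0, which is Jensen's inequality for exp *)
apply: (@le_trans _ _ (Z + ln x * (M - E * Z))).
  by rewrite lerDl mulr_ge0 // subr_ge0.
rewrite (_ : _ + _ = \sum_(I : {set V} | independent e I && (I \subset S))
    x^-1 ^+ #|I| * (1 + (#|I|%:R - E) * ln x)).
  rewrite mulr_sumr; apply: ler_sum => I _; rewrite mulr1.
  apply: (le_trans (ler_wpM2l _ (expR_ge1Dx _))).
    by rewrite exprn_ge0 // invr_ge0 ltW.
  (* The weight cancels the part of the exponent that depends on [#|I|], leaving the constant
     [expR (- (E * ln x))]. *)
  have -> : x^-1 = expR (- ln x) by rewrite expRN lnK.
  rewrite -expRM_natl -expRD le_eqVlt; apply/orP; left; apply/eqP.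
  by congr expR; ring.
rewrite mulrBr addrA /Z /M !mulr_sumr -big_split -sumrB /=.
by apply: eq_bigr => I _; ring.
Qed.

(** * Degree sums and vertices of low degree *)

(** At most two ordered pairs, [(a, b)] and [(b, a)], give the same edge. *)
Lemma sum_degree_le (V : finType) (e : rel V) :
  (\sum_v #|neighbours e v| <= 2 * #|edges e|)%N.
Proof.
have -> : (\sum_v #|neighbours e v| = #|[set p : V * V | e p.1 p.2]|)%N.
  rewrite -sum1_card (partition_big (fun p : V * V => p.1) xpredT) //=.
  apply: eq_bigr => v _; rewrite sum1_card.
  rewrite -(card_imset (mem (neighbours e v)) (f := pair v)) => [|a b []//].
  apply: eq_card => -[a b]; rewrite [RHS]unfold_in /= in_set /=.
  apply/imsetP/andP => [[c evc [-> ->]]|[eab /eqP <-]].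
    by split=> //; move: evc; rewrite in_set.
  by exists b => //; rewrite in_set.
rewrite -sum1_card (partition_big (fun p : V * V => [set p.1; p.2])
  (mem (edges e))) /=; last first.
  by move=> p; rewrite in_set => ep; apply/imsetP; exists p; rewrite ?in_set.
rewrite mulnC -sum_nat_const; apply: leq_sum => _ /imsetP[[a b] /= _ ->].
rewrite sum1_card; apply: (@leq_trans #|[set (a, b); (b, a)]|); last first.
  by rewrite cards2; case: eqP.
apply: subset_leq_card; apply/fintype.subsetP => -[c d].
rewrite !inE /= => /andP[_ /eqP/setP h].
have mem2 (u v w : V) : u \in [set v; w] -> u = v \/ u = w.
  by rewrite !inE => /orP[] /eqP; [left|right].
have ca : c = a \/ c = b by apply: mem2; rewrite -h set21.
have da : d = a \/ d = b by apply: mem2; rewrite -h set22.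
have ac : a = c \/ a = d by apply: mem2; rewrite h set21.
have bc : b = c \/ b = d by apply: mem2; rewrite h set22.
rewrite !xpair_eqE.
by case: ca; case: da; case: ac; case: bc => *; subst; rewrite ?eqxx ?orbT.
Qed.

(** Markov's inequality: the degrees sum to at most [t * #|V|], and each vertex outside the set
    accounts for more than [2 * t] of it. *)
Lemma low_degree_card_ge (R : realType) (V : finType) (e : rel V) :
  0 < average_degree R e ->
  #|V|%:R <= 2 * #|[set v : V | #|neighbours e v|%:R <=
     2 * average_degree R e]|%:R :> R.
Proof.
set t := average_degree R e => t0; set S := finset _.
have degE : \sum_v #|neighbours e v|%:R <= t * #|V|%:R :> R.
  rewrite /t /average_degree divfK; last first.
    (* An empty [V] would have average degree 0. *)
    by apply: contraTneq t0; rewrite /t /average_degree => ->; rewrite invr0 mulr0 ltxx.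
  by rewrite -natr_sum -natrM ler_nat sum_degree_le.
have : 2 * t * #|~: S|%:R <= t * #|V|%:R.
  apply: le_trans degE; rewrite (bigID (mem (~: S))) /= mulr_natr -sumr_const.
  rewrite -[leLHS]addr0 lerD ?sumr_ge0 //.
  by apply: ler_sum => v; rewrite !inE -ltNge => /ltW.
rewrite cardsCs setCK mulrAC [t * _]mulrC ler_pM2r //.
rewrite natrB ?max_card //.
lra.
Qed.

(** * Choice of parameters and comparison of constants *)

Theorem theorem1 (R : realType) :
  exists t0 : R,
    forall (V : finType) (e : rel V) (n : nat) (t : R),
      symmetric e -> irreflexive e -> triangle_free e ->
      #|V| = n -> average_degree R e = t -> t0 <= t ->
      2 `^ (n%:R / (2400 * t) * log2 t ^+ 2) <= (num_independent e)%:R :> R.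
Proof.
(* The threshold 1 makes [ln t] nonnegative. *)
exists 1 => V e n t sym irr tf nE tE t1.
have t0 : 0 < t by lra.
pose S := [set v : V | #|neighbours e v|%:R <= 2 * t].
have nS : n%:R <= 2 * #|S|%:R :> R.
  by rewrite -nE /S -tE; apply: low_degree_card_ge; rewrite tE.
(* Chosen so that [x ^+ 4] is the degree bound [2 * t]. *)
pose x : R := (2 * t) `^ 4^-1.
have x4 : x ^+ 4 = 2 * t.
  by rewrite -powR_mulrn ?powR_ge0 // -powRrM mulVf ?powRr1 //; lra.
have lnx : ln x = ln (2 * t) / 4 by rewrite /x ln_powR mulrC.
have lnt : 0 <= ln t by apply: ln_ge0.
have lnxt : ln t / 4 <= ln x.
  by rewrite lnx ler_pM2r ?invr_gt0 // ler_ln ?posrE; lra.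
have x1 : 1 <= x.
  by rewrite -(powRr0 (2 * t)); apply: ler_powR; [lra|rewrite invr_ge0].
have deg v : v \in S -> #|S :&: neighbours e v|%:R <= x ^+ 4.
  rewrite inE x4 => /(le_trans _); apply.
  by rewrite ler_nat subset_leq_card // subsetIr.
(* From [ln (1 + y) <= y] at [y = - 1/2]. *)
have ln2 : 1 / 2 <= ln 2 :> R.
  have := @le_ln1Dx R (- 2^-1).
  by rewrite (_ : 1 + - 2^-1 = 2^-1) ?lnV ?posrE; lra.
apply: le_trans (num_independent_ge R V e S x sym irr tf x1 deg).
rewrite /powR; case: eqP => [|_]; first lra.
rewrite ler_expR x4 /log2.
have tn0 : t != 0 by rewrite gt_eqF.
have ln2n0 : ln 2 != 0 :> R by rewrite gt_eqF //; lra.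
have -> : n%:R / (2400 * t) * (ln t / ln 2) ^+ 2 * ln 2 =
    n%:R * (ln t ^+ 2 / t) / (2400 * ln 2) :> R.
  by field; rewrite tn0 ln2n0.
(* The denominator is [8 * x ^+ 4 = 16 * t], and [ln x >= ln t / 4] costs another factor 16, so 256
   in all. With [n <= 2 * #|S|] it then suffices that [512 <= 2400 * ln 2], for which [ln 2 >= 1/2]
   is enough. *)
apply: (@le_trans _ _ (#|S|%:R * (ln t ^+ 2 / t) / 256)); last first.
  rewrite [leRHS](_ : _ = #|S|%:R * ((4 * ln x) ^+ 2 / t) / 256); last first.
    by field.
  rewrite ler_pM2r // ler_wpM2l // ler_pM2r ?invr_gt0 //.
  by apply: lerXn2r; rewrite ?nnegrE; lra.
have : 0 <= ln t ^+ 2 / t by rewrite divr_ge0 ?sqr_ge0 // ltW.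
move: (ln t ^+ 2 / t) => r r0.
rewrite ler_pdivrMr; last lra.
have : n%:R * r <= 2 * #|S|%:R * r by apply: ler_wpM2r.
have : 0 <= #|S|%:R * r by apply: mulr_ge0.
nra.
Qed.
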